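(* Let $n\ge 4$ and $k\ge 1$ be integers. Then \[ \gamma_{[k]R}(C_6\Box P_n)\le 6(n-2)\left\lceil\frac{k+5}{5}\right\rceil+12\left\lceil\frac{k+3-\left\lceil\frac{k+5}{5}\right\rceil}{3}\right\rceil-2\left\lceil\frac n2\right\rceil . \] Moreover, $\gamma_{[k]R}(C_6\Box P_n)\le \frac{6nk+55n+4k-20}{5}$ if $n$ is even, and $\gamma_{[k]R}(C_6\Box P_n)\le \frac{6nk+55n+4k-25}{5}$ if $n$ is odd.
   Context: For a graph $G$ and $v\in V(G)$, $N(v)$ is the open neighborhood and $N[v]=N(v)\cup\{v\}$. For an integer $k\ge1$, a function $f:V(G)\to\{0,1,\dots,k+1\}$ is a $[k]$-Roman dominating function if for every vertex $v$ with $f(v)<k$ we have $\sum_{u\in N[v]}f(u)\ge k+|\{u\in N(v): f(u)>0\}|$. The weight of $f$ is $\sum_{v}f(v)$, and $\gamma_{[k]R}(G)$ is the minimum weight of a $[k]$-Roman dominating function on $G$. $C_m\Box P_n$ is the Cartesian product of the cycle $C_m$ (vertices $0,\dots,m-1$ mod $m$) and the path $P_n$ (vertices $0,\dots,n-1$): $(i,j)\sim(i',j')$ iff ($i=i'$ and $|j-j'|=1$) or ($j=j'$ and $i'\equiv i\pm1 \pmod m$). *)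

(* Defs.v *)
From mathcomp Require Import all_boot.

Set Implicit Arguments.
Unset Strict Implicit.
Unset Printing Implicit Defensive.

(* A graph is given by its adjacency relation [e] on a finite vertex type. *)
Section Graph.
Variables (T : finType) (e : rel T).

Definition open_nbhd (v : T) : {set T} := [set u | e v u].

Definition closed_nbhd (v : T) : {set T} := v |: open_nbhd v.

Definition weight (k : nat) (f : {ffun T -> 'I_k.+2}) : nat := \sum_v f v.

Definition kRoman_dominating (k : nat) (f : {ffun T -> 'I_k.+2}) : bool :=
  [forall v, (f v < k) ==>
    (k + #|[set u in open_nbhd v | 0 < f u]| <= \sum_(u in closed_nbhd v) f u)].

Lemma kRoman_dominating_max k :
  kRoman_dominating [ffun _ : T => (ord_max : 'I_k.+2)].
Proof. by apply/forallP => v; rewrite ffunE /= ltnNge leqnSn. Qed.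

(* The constant function k+1 only seeds the search; it is always
   k-Roman dominating, so the minimum is attained (see kRoman_numberP). *)
Definition kRoman_number (k : nat) : nat :=
  weight [arg min_(f < [ffun _ : T => (ord_max : 'I_k.+2)]
                   | kRoman_dominating f) weight f].

Lemma kRoman_numberP k :
  (exists2 f : {ffun T -> 'I_k.+2},
     kRoman_dominating f & weight f = kRoman_number k) /\
  (forall f : {ffun T -> 'I_k.+2},
     kRoman_dominating f -> kRoman_number k <= weight f).
Proof.
rewrite /kRoman_number; case: arg_minnP => [|f Pf fmin].
  exact: kRoman_dominating_max.
by split=> //; exists f.
Qed.

End Graph.

Definition cycle_adj (m : nat) : rel 'I_m :=
  [rel i i' : 'I_m | (i' == i.+1 %[mod m]) || (i == i'.+1 %[mod m])].

Definition path_adj (n : nat) : rel 'I_n :=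
  [rel j j' : 'I_n | (j' == j.+1 :> nat) || (j == j'.+1 :> nat)].

Definition cart_adj (T1 T2 : finType) (e1 : rel T1) (e2 : rel T2) :
    rel (T1 * T2) :=
  [rel x y | (x.1 == y.1) && e2 x.2 y.2 || (x.2 == y.2) && e1 x.1 y.1].

Definition cycle_path_adj (m n : nat) : rel ('I_m * 'I_n) :=
  cart_adj (@cycle_adj m) (@path_adj n).

Lemma cycle_path_adj_sym m n : symmetric (@cycle_path_adj m n).
Proof.
move=> [i j] [i' j']; rewrite /cycle_path_adj /cart_adj /=.
rewrite (eq_sym i') (eq_sym j'); congr ((_ && _) || (_ && _)); exact: orbC.
Qed.

Lemma cycle_path_adj_irr m n : 1 < m -> irreflexive (@cycle_path_adj m n).
Proof.
move=> m_gt1 [i j]; rewrite /cycle_path_adj /cart_adj /= !eqxx.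
rewrite /path_adj /cycle_adj /= !orbb.
rewrite (ltn_eqF (ltnSn j)) /= -addn1 -[X in X == _ %[mod m]]addn0 eqn_modDl.
by rewrite mod0n modn_small.
Qed.

(* Main.v *)
Require Import Defs.
From mathcomp Require Import all_boot all_order all_algebra.
From mathcomp Require Import zify lra.

(* Put a = ceil((k+5)/5) and b = ceil((k+3-a)/3). The constant function a on the
   inner layers and b on the two end layers is dominating, with slack in the
   constraint of every inner vertex: lowering the two vertices of column class c
   mod 3 in every other layer, with c advancing from one lowered layer to the
   next, costs each closed neighbourhood at most one unit. This saves 2 ceil(n/2)
   outright unless the end layers are tight, 3b + a = k + 3.
   In the tight case the layers next to the ends usually have slack at least 3:
   lowering them entirely, raising two vertices in each end layer, and thinning
   out only layers 4, 6, ... saves the same amount.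
   The cases left over are k = 5, 9, 20. There, k + 1 times a dominating set of
   C_6 x P_n with about 4n/3 elements is good enough, except for k = 20 and
   n = 5, 6, 8, 9, 11, 14, where explicit functions are found by search. *)

Set Implicit Arguments.
Unset Strict Implicit.
Unset Printing Implicit Defensive.

(** * Upper bounds from layered functions *)

(* F i j is the value in column i and layer j. A positive neighbour u contributes
   f(u) - 1 to the domination inequality and a zero one contributes 0, hence the
   truncated predecessors. *)
Definition locally_dominating (n k : nat) (F : nat -> nat -> nat) (i j : nat) :=
  F i j < k ->
  k <= F i j + (F (i.+1 %% 6) j).-1 + (F ((i + 5) %% 6) j).-1
       + (if 0 < j then (F i j.-1).-1 else 0)
       + (if j.+1 < n then (F i j.+1).-1 else 0).

Lemma leq_sum_uniq_subset (T : finType) (A : {set T}) (G : T -> nat) (s : seq T) :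
  uniq s -> all [in A] s -> \sum_(u <- s) G u <= \sum_(u in A) G u.
Proof.
move=> s_uniq /allP sA; rewrite big_uniq //= !(big_mkcond (fun u => u \in _)) /=.
apply: leq_sum => u _; case: ifP => // us; have /= -> := sA _ us; exact: leqnn.
Qed.

(** Splitting [f u] into [(f u).-1 + (0 < f u)] cancels the count of positive neighbours. Only a
    lower bound on the remaining sum is needed, so it suffices that the listed vertices are distinct
    neighbours. *)
Lemma kRoman_number_le_sum (n k : nat) (F : nat -> nat -> nat) :
  (forall i j, i < 6 -> j < n -> F i j <= k.+1) ->
  (forall i j, i < 6 -> j < n -> locally_dominating n k F i j) ->
  kRoman_number (@cycle_path_adj 6 n) k <= \sum_(j < n) \sum_(i < 6) F i j.
Proof.
move=> F_le F_dom.
pose f := [ffun v : 'I_6 * 'I_n => (inord (F v.1 v.2) : 'I_k.+2)].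
have fE (v : 'I_6 * 'I_n) : f v = F v.1 v.2 :> nat.
  by rewrite ffunE inordK // ltnS F_le.
have -> : \sum_(j < n) \sum_(i < 6) F i j = weight f.
  rewrite /weight exchange_big pair_big /=.
  by apply: eq_bigr => v _; rewrite fE.
apply: (kRoman_numberP _ k).2.
apply/forallP => -[i j]; apply/implyP; set v := (i, j) => fvk.
have vN : v \notin open_nbhd (@cycle_path_adj 6 n) v.
  by rewrite inE cycle_path_adj_irr.
rewrite /closed_nbhd big_setU1 //=.
set N := open_nbhd _ v.
have -> : #|[set u in N | 0 < f u]| = \sum_(u in N) (0 < f u).
  rewrite -sum1_card (eq_bigl (fun u => (u \in N) && (0 < f u))); last first.
    by move=> u; rewrite inE.
  by rewrite big_mkcondr; apply: eq_bigr => u _; case: (0 < _).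
have -> : \sum_(u in N) f u = \sum_(u in N) (f u).-1 + \sum_(u in N) (0 < f u).
  by rewrite -big_split; apply: eq_bigr => u _ /=; case: (nat_of_ord (f u)); lia.
rewrite addnA leq_add2r.
have ltS6 : i.+1 %% 6 < 6 by rewrite ltn_mod.
have ltP6 : (i + 5) %% 6 < 6 by rewrite ltn_mod.
(* The guard [0 < j] matters: for [j = 0] the truncated [j.-1] would list the vertex itself. *)
pose below := if insub j.-1 is Some j' then
   if 0 < j then [:: (i, j') : 'I_6 * 'I_n] else [::] else [::].
pose above := if insub j.+1 is Some j' then [:: (i, j') : 'I_6 * 'I_n] else [::].
pose s := [:: (Ordinal ltS6, j); (Ordinal ltP6, j)] ++ below ++ above.
have s_uniq : uniq s.
  rewrite /s /below /above.
  case: (insubP 'I_n j.-1) => [j1 _ /= j1E|_]; case: (insubP 'I_n j.+1) => [j2 _ /= j2E|_];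
    case: (ltnP 0 j) => j0 //=; rewrite !inE -!pair_eqE /= -!val_eqE /= ?j1E ?j2E; lia.
have NE u : (u \in N) = cycle_path_adj v u by rewrite inE.
have sN : all [in N] s.
  have own : cycle_path_adj v (Ordinal ltS6, j) && cycle_path_adj v (Ordinal ltP6, j).
    rewrite /cycle_path_adj /cart_adj /cycle_adj /= !eqxx /= -!val_eqE /=.
    by case: (i) {ltS6 ltP6 s_uniq s} => -[|[|[|[|[|[|[]]]]]]].
  case/andP: own => own1 own2.
  rewrite /s /below /above; case: (insubP 'I_n j.-1) => [j1 _ /= j1E|_];
    case: (insubP 'I_n j.+1) => [j2 _ /= j2E|_]; case: (ltnP 0 j) => j0 //=;
    rewrite !NE own1 own2 /cycle_path_adj /cart_adj /path_adj /= ?eqxx /= ?j1E ?j2E; lia.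
have := leq_sum_uniq_subset (fun u => (f u).-1) s_uniq sN.
rewrite fE /= in fvk; have := F_dom i j (ltn_ord i) (ltn_ord j) fvk.
rewrite fE /s /below /above !big_cat !big_cons big_nil /= !fE /=.
case: (insubP 'I_n j.-1) => [j1 _ /= j1E|/= nj1]; case: (insubP 'I_n j.+1) => [j2 j2n /= j2E|/= nj2];
  case: (ltnP 0 j) => j0; rewrite ?big_cons ?big_nil ?fE /= ?j1E ?j2E;
  have := ltn_ord j; rewrite ?j2n ?(negPf nj2); lia.
Qed.

(** * End layers with slack *)

Definition base (n a b j : nat) := if (j == 0) || (j == n.-1) then b else a.

Definition twisted (i j : nat) : bool := ~~ odd j && (i %% 3 == j./2 %% 3).

(** Each neighbour loses at most one in passing to its predecessor, so exceeding [k] by the degree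
    is enough. *)
Lemma locally_dominating_sum n k F i j :
  k + (2 + (0 < j) + (j.+1 < n)) <=
    F i j + F (i.+1 %% 6) j + F ((i + 5) %% 6) j
    + (if 0 < j then F i j.-1 else 0) + (if j.+1 < n then F i j.+1 else 0) ->
  locally_dominating n k F i j.
Proof. rewrite /locally_dominating => + _; case: (ltnP 0 j); case: (ltnP j.+1 n); lia. Qed.

Lemma base_ge1 n a b j : 0 < a -> 0 < b -> 0 < base n a b j.
Proof. by rewrite /base; case: ifP. Qed.

Lemma base_first n a b : base n a b 0 = b.
Proof. by []. Qed.

Lemma base_last n a b j : j.+1 = n -> base n a b j = b.
Proof. by move=> <-; rewrite /base eqxx orbT. Qed.

Lemma base_inner n a b j : 0 < j -> j.+1 < n -> base n a b j = a.
Proof. by rewrite /base => j0 jn; case: ifP => //; lia. Qed.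

Lemma sum_base n a b : 2 <= n -> \sum_(j < n) base n a b j = 2 * b + (n - 2) * a.
Proof.
case: n => [|[|n]] // _; rewrite big_ord_recl big_ord_recr /= {1 3}/base /= eqxx.
rewrite (eq_bigr (fun=> a)) => [|j _]; last first.
  by rewrite /base /= /bump /= add1n eqSS ltn_eqF ?ltn_ord.
by rewrite sum_nat_const card_ord; lia.
Qed.

Lemma sum_even n : \sum_(j < n) ~~ odd j = uphalf n.
Proof. by elim: n => [|n IH]; rewrite ?big_ord0 // big_ord_recr /= IH; lia. Qed.

Lemma sum6 (F : nat -> nat) :
  \sum_(i < 6) F i = F 0 + F 1 + F 2 + F 3 + F 4 + F 5.
Proof. by rewrite !big_ord_recr big_ord0. Qed.

(** Three consecutive columns of the 6-cycle represent each residue mod 3 once, since 3 divides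
    6. *)
Lemma twisted_row i j : i < 6 ->
  twisted i j + twisted (i.+1 %% 6) j + twisted ((i + 5) %% 6) j = ~~ odd j.
Proof.
move=> i6; rewrite /twisted; case: (odd j) => //=.
have: j./2 %% 3 < 3 by rewrite ltn_mod.
by case: (j./2 %% 3) => [|[|[|]]] //; case: i i6 => [|[|[|[|[|[]]]]]].
Qed.

(** For odd [j] the layers on both sides have consecutive halves, hence different residues mod 3. *)
Lemma twisted_col i j : ((0 < j) && twisted i j.-1) + twisted i j.+1 <= odd j.
Proof.
case: j => [|j] //=; rewrite /twisted /= negbK; case: (odd j) => //=.
have: j./2 %% 3 < 3 by rewrite ltn_mod.
by rewrite -[j./2.+1]addn1 -modnDml; case: (j./2 %% 3) => [|[|[|]]] //;
  case: (i %% 3) => [|[|[|]]].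
Qed.

Lemma twisted_layer j : \sum_(i < 6) twisted i j = 2 * ~~ odd j.
Proof.
rewrite (sum6 (fun i => twisted i j)) /twisted; case: (odd j) => //=.
have: j./2 %% 3 < 3 by rewrite ltn_mod.
by case: (j./2 %% 3) => [|[|[|]]].
Qed.

(** A vertex in an even layer loses one unit through its row, a vertex in an odd layer at most one
    through its column. So the three inequalities ask for one unit beyond [k] plus the degree: away
    from the ends, in an end layer, and next to one. *)
Lemma kRoman_number_slack n k a b :
  4 <= n -> 1 <= a <= k.+1 -> 1 <= b <= k.+1 ->
  k + 5 <= 5 * a -> k + 4 <= 3 * b + a -> k + 5 <= 4 * a + b ->
  kRoman_number (@cycle_path_adj 6 n) k + 2 * uphalf n <= 6 * (n - 2) * a + 12 * b.
Proof.
move=> n4 /andP[a1 ak] /andP[b1 bk] inner outer next.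
pose F i j := base n a b j - twisted i j.
have FE i j : F i j + twisted i j = base n a b j.
  by rewrite subnK //; have := @base_ge1 n a b j a1 b1; case: twisted.
have F_le i j : F i j <= k.+1.
  by rewrite (leq_trans (leq_subr _ _)) // /base; case: ifP.
have F_dom i j : i < 6 -> j < n -> locally_dominating n k F i j.
  move=> i6 jn; apply: locally_dominating_sum.
  have := twisted_row j i6; have := twisted_col i j.
  have := FE i j; have := FE (i.+1 %% 6) j; have := FE ((i + 5) %% 6) j.
  have [->|j0] := posnP j.
    have -> : (1 < n) by lia.
    by have := FE i 1; rewrite /= base_first base_inner; lia.
  have [jn1|jn1] := ltnP j.+1 n; last first.
    by have := FE i j.-1; rewrite (@base_last _ _ _ j) ?base_inner; lia.
  have := FE i j.-1; have := FE i j.+1; rewrite (@base_inner _ _ _ j) //.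
  case: (posnP j.-1) => [j1|j1]; first by rewrite j1 base_first (@base_inner _ _ _ j.+1) //; lia.
  rewrite (@base_inner _ _ _ j.-1) //; last by lia.
  case: (ltnP j.+2 n) => jn2; first by rewrite (@base_inner _ _ _ j.+1) //; lia.
  by rewrite (@base_last _ _ _ j.+1); lia.
have := kRoman_number_le_sum (fun i j _ _ => F_le i j) F_dom.
have -> : 6 * (n - 2) * a + 12 * b = \sum_(j < n) 6 * base n a b j.
  by rewrite -big_distrr /= sum_base; lia.
move=> le_sum; rewrite -sum_even big_distrr /=.
apply: leq_trans (leq_add le_sum (leqnn _)) _; rewrite -big_split leq_sum //= => j _.
rewrite -twisted_layer -big_split /=.
rewrite (eq_bigr (fun=> base n a b j)) => [|i _]; last first.
  by exact: FE.
by rewrite sum_nat_const card_ord.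
Qed.

(** * Tight end layers *)

(* For n = 5 both lowered layers are adjacent to layer 2, which is raised to
   compensate; for n = 4 a single lowered layer suffices. *)
Definition raised (n j : nat) : bool :=
  (j == 0) || ((j.+1 == n) && (4 < n)) || ((n == 5) && (j == 2)).

Definition lowered (n j : nat) : bool := (j == 1) || ((j.+2 == n) && (4 < n)).

(** Thinned layers stay at distance at least 3 from lowered ones, so no closed neighbourhood meets
    both. *)
Definition thinned (n j : nat) : bool := (4 <= j) && (j + 4 < n).

Definition up (n i j : nat) : bool := raised n j && (i %% 3 == 0).

Definition down (n i j : nat) : bool := lowered n j || thinned n j && twisted i j.

Lemma up_row n i j : i < 6 ->
  up n i j + up n (i.+1 %% 6) j + up n ((i + 5) %% 6) j = raised n j.
Proof. by rewrite /up; case: raised => //; case: i => [|[|[|[|[|[]]]]]]. Qed.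

Lemma up_layer n j : \sum_(i < 6) up n i j = 2 * raised n j.
Proof. by rewrite (sum6 (fun i => up n i j)) /up; case: raised. Qed.

Lemma down_row n i j : i < 6 ->
  down n i j + down n (i.+1 %% 6) j + down n ((i + 5) %% 6) j
    = 3 * lowered n j + (thinned n j && ~~ odd j).
Proof.
move=> i6; have := twisted_row j i6; rewrite /down.
have: ~~ (lowered n j && thinned n j) by rewrite /lowered /thinned; lia.
by case: lowered; case: thinned => //= _ ->.
Qed.

Lemma down_layer n j :
  \sum_(i < 6) down n i j = 6 * lowered n j + 2 * (thinned n j && ~~ odd j).
Proof.
have: ~~ (lowered n j && thinned n j) by rewrite /lowered /thinned; lia.
have := twisted_layer j; rewrite (sum6 (fun i => down n i j)) (sum6 (fun i => twisted i j)).
by rewrite /down; case: lowered; case: thinned => //= ->.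
Qed.

(** The weight balance in units of two: raising costs one per layer, the saving aimed at is one per
    even layer, and lowering a whole layer gains three. *)
Lemma raised_lowered_sum n : 4 <= n ->
  \sum_(j < n) (raised n j + ~~ odd j)
    <= \sum_(j < n) (3 * lowered n j + (thinned n j && ~~ odd j)).
Proof.
(* From [n = 8] on, the four layers at each end are compared separately; in between, all layers are
   thinned and both sides agree termwise. *)
case: n => [|[|[|[|[|[|[|[|m]]]]]]]] // _; try by rewrite !big_ord_recr !big_ord0.
have -> : m.+4.+4 = 4 + (m + 4) by rewrite addnA add4n addn4.
set n := 4 + (m + 4).
rewrite 2!big_split_ord /= [in leqRHS]big_split_ord /= [in leqRHS]big_split_ord /=.
have mid (i : 'I_m) : [/\ raised n (4 + i) = false, lowered n (4 + i) = false
                       & thinned n (4 + i)].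
  have := ltn_ord i; rewrite /raised /lowered /thinned /n; split; lia.
have -> : \sum_(i < m) (3 * lowered n (4 + i) + (thinned n (4 + i) && ~~ odd (4 + i)))
          = \sum_(i < m) (raised n (4 + i) + ~~ odd (4 + i)).
  by apply: eq_bigr => i _; have [-> -> ->] := mid i.
move: (\sum_(i < m) _) => M.
rewrite !big_ord_recr !big_ord0 /= !addnA !addn0 !add0n.
have [-> -> ->] : [/\ raised n 1 = false, raised n 2 = false & raised n 3 = false].
  by rewrite /raised /n; split; lia.
have [-> -> -> ->] : [/\ raised n (4 + m) = false, raised n (4 + m + 1) = false,
    raised n (4 + m + 2) = false & raised n (4 + m + 3)].
  by rewrite /raised /n; split; lia.
have [-> ->] : lowered n 2 = false /\ lowered n 3 = false.
  by rewrite /lowered /n; split; lia.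
have [-> -> -> ->] : [/\ lowered n (4 + m) = false, lowered n (4 + m + 1) = false,
    lowered n (4 + m + 2) & lowered n (4 + m + 3) = false].
  by rewrite /lowered /n; split; lia.
have [-> -> -> ->] : [/\ thinned n (4 + m) = false, thinned n (4 + m + 1) = false,
    thinned n (4 + m + 2) = false & thinned n (4 + m + 3) = false].
  by rewrite /thinned /n; split; lia.
by rewrite !oddD /=; case: (odd m) => /=; lia.
Qed.

(** Only layers [2] and [n - 3] touch a lowered layer, and they touch no thinned one; they coincide
    when [n = 5], where the raise pays for the second loss. Elsewhere [twisted_col] applies. *)
Lemma down_inner n i j : 2 <= j -> j + 3 <= n ->
  (thinned n j && ~~ odd j) + down n i j.-1 + down n i j.+1 <= 1 + raised n j.
Proof.
move=> j2 jn; have [j0 j1] : 0 < j /\ j.-1.+2 = j.+1 by split; lia.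
have := twisted_col i j; rewrite j0 /= /down.
have -> : lowered n j.-1 = (j == 2) by rewrite /lowered; lia.
have -> : lowered n j.+1 = (j + 3 == n) by rewrite /lowered; lia.
have [jE|j_neq2] := eqVneq j 2.
  have -> : thinned n j = false by rewrite /thinned; lia.
  have -> : raised n j = (n == 5) by rewrite /raised; lia.
  have -> : thinned n j.+1 = false by rewrite /thinned; lia.
  by case: (n =P 5) => [->|n5]; rewrite jE //; case: eqP => //; lia.
have [jE|j_neq] := eqVneq (j + 3) n.
  have -> : thinned n j = false by rewrite /thinned; lia.
  by have -> : thinned n j.-1 = false by rewrite /thinned; lia.
move: (twisted i j.-1) (twisted i j.+1) (thinned n j) (thinned n j.-1) (thinned n j.+1).
by case: (odd j) => -[] [] [] [] [].
Qed.

(** In an end layer, a raise in the row offsets a loss from a lowered neighbour. A vertex of a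
    lowered layer loses three units in its own row, whence [k + 7]. The bounds [a <= k] and [b <= k]
    leave room for the raise. *)
Lemma kRoman_number_tight n k a b :
  4 <= n -> 1 <= a <= k -> 1 <= b <= k ->
  k + 5 <= 5 * a -> k + 3 <= 3 * b + a -> k + 7 <= 4 * a + b ->
  kRoman_number (@cycle_path_adj 6 n) k + 2 * uphalf n <= 6 * (n - 2) * a + 12 * b.
Proof.
move=> n4 /andP[a1 ak] /andP[b1 bk] inner outer next.
pose F i j := base n a b j + up n i j - down n i j.
have FE i j : F i j + down n i j = base n a b j + up n i j.
  by rewrite subnK //; have := @base_ge1 n a b j a1 b1; case: down; case: up; lia.
have F_le i j : F i j <= k.+1.
  rewrite (leq_trans (leq_subr _ _)) // -addn1 leq_add ?leq_b1 //.
  by rewrite /base; case: ifP.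
have F_dom i j : i < 6 -> j < n -> locally_dominating n k F i j.
  move=> i6 jn; apply: locally_dominating_sum.
  have own : F i j + F (i.+1 %% 6) j + F ((i + 5) %% 6) j
      + (3 * lowered n j + (thinned n j && ~~ odd j)) = 3 * base n a b j + raised n j.
    have := FE i j; have := FE (i.+1 %% 6) j; have := FE ((i + 5) %% 6) j.
    rewrite -(up_row n j i6) -(down_row n j i6).
    move: (down n i j) (down n _ j) (down n _ j) (up n i j) (up n _ j) (up n _ j).
    by move=> [] [] [] [] [] []; lia.
  have col x : base n a b x <= F i x + down n i x by rewrite FE leq_addr.
  move: own; move: (F i j + _ + _) => S own.
  have [j0|j0] := posnP j.
    have := col 1; have := leq_b1 (down n i 1); move: own.
    have -> : (j.+1 < n) by lia.
    rewrite j0 base_first base_inner //; last by lia.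
    have -> : lowered n 0 = false by rewrite /lowered; lia.
    have -> : thinned n 0 = false by [].
    by move=> /=; lia.
  have [jn1|jn1] := ltnP j.+1 n; last first.
    have := col j.-1; move: own; rewrite (@base_last _ _ _ j) ?base_inner //; try lia.
    have -> : lowered n j = false by rewrite /lowered; lia.
    have -> : thinned n j = false by rewrite /thinned; lia.
    have -> : raised n j = (4 < n) by rewrite /raised; lia.
    case: (ltnP 4 n) => n4'; first by have := leq_b1 (down n i j.-1); lia.
    have -> : down n i j.-1 = false by rewrite /down /lowered /thinned; lia.
    lia.
  have := col j.-1; have := col j.+1; move: own; rewrite (@base_inner _ _ _ j) //.
  have [j1|j2] := leqP j 1.
    have -> : j.-1 = 0 by lia.
    have -> : down n i 0 = false by rewrite /down /lowered /thinned; lia.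
    have -> : down n i j.+1 = false by rewrite /down /lowered /thinned; lia.
    have -> : lowered n j by rewrite /lowered; lia.
    have -> : thinned n j = false by rewrite /thinned; lia.
    rewrite base_first base_inner //; lia.
  rewrite (@base_inner _ _ _ j.-1) //; try lia.
  have [jn2|jn2] := leqP n j.+2.
    rewrite (@base_last _ _ _ j.+1); last by lia.
    have -> : down n i j.+1 = false by rewrite /down /lowered /thinned; lia.
    have -> : thinned n j = false by rewrite /thinned; lia.
    case: (ltnP 4 n) => n4'.
      have -> : down n i j.-1 = false by rewrite /down /lowered /thinned; lia.
      have -> : lowered n j by rewrite /lowered; lia.
      lia.
    have -> : lowered n j = false by rewrite /lowered; lia.
    have := leq_b1 (down n i j.-1); lia.
  rewrite (@base_inner _ _ _ j.+1) //.
  have -> : lowered n j = false by rewrite /lowered; lia.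
  have := @down_inner n i j j2; lia.
have := kRoman_number_le_sum (fun i j _ _ => F_le i j) F_dom.
have -> : 6 * (n - 2) * a + 12 * b = \sum_(j < n) 6 * base n a b j.
  by rewrite -big_distrr /= sum_base; lia.
have := raised_lowered_sum n4; rewrite big_split /= sum_even.
have: \sum_(j < n) (\sum_(i < 6) F i j
         + 2 * (3 * lowered n j + (thinned n j && ~~ odd j)))
      = \sum_(j < n) (6 * base n a b j + 2 * raised n j).
  apply: eq_bigr => j _; rewrite mulnDr mulnA -down_layer -up_layer -big_split /=.
  under eq_bigr do rewrite FE.
  rewrite big_split /=.
  by rewrite sum_nat_const card_ord.
by rewrite !big_split /= !big1_eq; lia.
Qed.

(** * The exceptional values of k *)

(* The layers have period 3, {0,2}, {4}, {1}, and each period is shifted by three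
   columns; p is the parity of the number of periods passed. A last layer that
   is not of the first kind is replaced with {1,4}. *)
Definition code_pattern (last p : bool) (i r : nat) : bool :=
  let i' := (i + 3 * p) %% 6 in
  if last && (r != 0) then i' \in [:: 1; 4] else
  match r with 0 => i' \in [:: 0; 2] | 1 => i' == 4 | _ => i' == 1 end.

Definition code (n i j : nat) : bool :=
  code_pattern (j.+1 == n) (odd (j %/ 3)) i (j %% 3).

(** Up to the shift, [{0,2}] misses only column 4, [{4}] misses 0, 2 and 1, and [{1}] misses 4, 3
    and 5; adjacent layers supply these. A final [{1,4}] dominates its whole cycle. *)
Lemma code_dominating n i j : 1 < n -> i < 6 -> j < n ->
  [|| code n i j, code n (i.+1 %% 6) j, code n ((i + 5) %% 6) j,
      (0 < j) && code n i j.-1 | (j.+1 < n) && code n i j.+1].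
Proof.
move=> n1 i6 jn; rewrite /code.
have : j %% 3 < 3 by rewrite ltn_mod.
case r: (j %% 3) => [|[|[|]]] // _.
- have [-> ->] : j.+1 %/ 3 = j %/ 3 /\ j.+1 %% 3 = 1 by lia.
  have [jn1|jn1] := ltnP j.+1 n.
    by move: (odd (j %/ 3)) (j.+1 == n) (j.+2 == n) i6 => p l l1; case: i p l l1 => [|[|[|[|[|[]]]]]] // [] [] [] _; rewrite /= ?orbT.
  (* A last layer of the first kind gets its missing column from the preceding period, whose set
     [{1}] is shifted by three. *)
  have -> : 0 < j by lia.
  have [-> ->] : odd (j.-1 %/ 3) = ~~ odd (j %/ 3) /\ j.-1 %% 3 = 2 by lia.
  have -> : (j.-1.+1 == n) = false by lia.
  by move: (odd (j %/ 3)) (j.+1 == n) i6 => p l; case: i p l => [|[|[|[|[|[]]]]]] // [] [] _; rewrite /= ?orbT.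
- have [-> ->] : j.-1 %/ 3 = j %/ 3 /\ j.-1 %% 3 = 0 by lia.
  have [-> ->] : j.+1 %/ 3 = j %/ 3 /\ j.+1 %% 3 = 2 by lia.
  have -> : 0 < j by lia.
  have [jn1|jn1] := ltnP j.+1 n.
    have [-> ->] : (j.+1 == n) = false /\ (j.-1.+1 == n) = false by lia.
    by move: (odd (j %/ 3)) (j.+2 == n) i6 => p l; case: i p l => [|[|[|[|[|[]]]]]] // [] [] _; rewrite /= ?orbT.
  have -> : j.+1 == n by lia.
  by move: (odd (j %/ 3)) (j.-1.+1 == n) i6 => p l; case: i p l => [|[|[|[|[|[]]]]]] // [] [] _; rewrite /= ?orbT.
have [-> ->] : j.-1 %/ 3 = j %/ 3 /\ j.-1 %% 3 = 1 by lia.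
have [-> ->] : odd (j.+1 %/ 3) = ~~ odd (j %/ 3) /\ j.+1 %% 3 = 0 by lia.
have -> : 0 < j by lia.
have -> : (j.-1.+1 == n) = false by lia.
have [jn1|jn1] := ltnP j.+1 n.
  have -> : (j.+1 == n) = false by lia.
  by move: (odd (j %/ 3)) (j.+2 == n) i6 => p l; case: i p l => [|[|[|[|[|[]]]]]] // [] [] _; rewrite /= ?orbT.
have -> : j.+1 == n by lia.
by move: (odd (j %/ 3)) i6 => p; case: i p => [|[|[|[|[|[]]]]]] // [] _; rewrite /= ?orbT.
Qed.

Lemma code_layer n j :
  \sum_(i < 6) code n i j = 1 + (j %% 3 == 0) + ((j.+1 == n) && (j %% 3 != 0)).
Proof.
rewrite (sum6 (fun i => code n i j)) /code.
have : j %% 3 < 3 by rewrite ltn_mod.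
by case: (j %% 3) => [|[|[|]]] //; case: (odd _) => //; case: (_ == n).
Qed.

Lemma code_size n : 0 < n ->
  \sum_(j < n) \sum_(i < 6) code n i j = n + (n + 2) %/ 3 + (n %% 3 != 1).
Proof.
case: n => // n _; under eq_bigr do rewrite code_layer.
rewrite big_split big_split /= sum1_card card_ord; congr (_ + _ + _).
  by elim: n.+1 => [|m IH]; rewrite ?big_ord0 // big_ord_recr /= IH; lia.
rewrite big_ord_recr big1 /= => [|j _]; last by have := ltn_ord j; lia.
by rewrite eqxx /=; lia.
Qed.

(** A code vertex has value [k + 1] and is exempt; any other has a code neighbour contributing
    exactly [k]. *)
Lemma kRoman_number_code n k : 1 < n ->
  kRoman_number (@cycle_path_adj 6 n) k
    <= k.+1 * (n + (n + 2) %/ 3 + (n %% 3 != 1)).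
Proof.
move=> n1.
have -> : k.+1 * (n + (n + 2) %/ 3 + (n %% 3 != 1))
        = \sum_(j < n) \sum_(i < 6) k.+1 * code n i j.
  rewrite -code_size 1?ltnW // big_distrr.
  by apply: eq_bigr => j _; rewrite big_distrr.
apply: (@kRoman_number_le_sum n k (fun i j => k.+1 * code n i j)) => i j i6 jn.
  by rewrite -[leqRHS]muln1 leq_mul2l leq_b1 orbT.
have := code_dominating n1 i6 jn; rewrite /locally_dominating.
case/or4P => [->|->|->|/orP[]/andP[-> ->]]; lia.
Qed.

Definition table_entry (t : seq (seq nat)) (i j : nat) := nth 0 (nth [::] t j) i.

(** A boolean form of [locally_dominating] with the value bound, so that a table is checked by
    evaluation. *)
Definition table_dominating (k : nat) (t : seq (seq nat)) : bool :=
  let F := table_entry t in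
  all (fun j => (size (nth [::] t j) == 6) && all (fun i => (F i j <= k.+1) &&
    ((F i j < k) ==>
     (k <= F i j + (F (i.+1 %% 6) j).-1 + (F ((i + 5) %% 6) j).-1
       + (if 0 < j then (F i j.-1).-1 else 0)
       + (if j.+1 < size t then (F i j.+1).-1 else 0)))) (iota 0 6)) (iota 0 (size t)).

Lemma kRoman_number_table k t : table_dominating k t ->
  kRoman_number (@cycle_path_adj 6 (size t)) k <= sumn (map sumn t).
Proof.
move=> /allP t_dom.
have -> : sumn (map sumn t) = \sum_(j < size t) \sum_(i < 6) table_entry t i j.
  rewrite sumnE big_map (big_nth [::]) big_mkord; apply: eq_bigr => j _.
  have /t_dom/andP[/eqP size6 _] : val j \in iota 0 (size t) by rewrite mem_iota /=.
  by rewrite sumnE (big_nth 0) big_mkord size6.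
apply: kRoman_number_le_sum => i j i6 jn;
  have /t_dom/andP[_ /allP row_dom] : j \in iota 0 (size t) by rewrite mem_iota.
  by have /row_dom/andP[] : i \in iota 0 6 by rewrite mem_iota.
by have /row_dom/andP[_ /implyP] : i \in iota 0 6 by rewrite mem_iota.
Qed.

Definition table5 : seq (seq nat) :=
  [:: [:: 7; 0; 15; 0; 7; 8];
      [:: 7; 0; 8; 0; 8; 0];
      [:: 8; 8; 0; 7; 7; 0];
      [:: 0; 7; 0; 8; 0; 8];
      [:: 0; 7; 8; 7; 0; 15]].

Definition table6 : seq (seq nat) :=
  [:: [:: 0; 13; 8; 13; 0; 9];
      [:: 0; 0; 9; 0; 0; 12];
      [:: 10; 0; 12; 0; 10; 0];
      [:: 11; 0; 0; 0; 11; 0];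
      [:: 0; 11; 10; 11; 0; 0];
      [:: 0; 0; 11; 0; 0; 21]].

Definition table8 : seq (seq nat) :=
  [:: [:: 9; 0; 13; 0; 9; 4];
      [:: 9; 0; 8; 0; 10; 0];
      [:: 8; 6; 0; 5; 8; 0];
      [:: 0; 8; 5; 9; 0; 7];
      [:: 0; 8; 0; 8; 0; 14];
      [:: 0; 11; 3; 11; 0; 0];
      [:: 11; 0; 0; 0; 11; 10];
      [:: 0; 0; 21; 0; 0; 11]].

Definition table9 : seq (seq nat) :=
  [:: [:: 0; 0; 0; 21; 0; 21];
      [:: 0; 21; 0; 0; 0; 0];
      [:: 0; 0; 0; 0; 21; 0];
      [:: 21; 0; 21; 0; 0; 0];
      [:: 0; 0; 0; 0; 14; 7];
      [:: 0; 21; 0; 9; 0; 0];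
      [:: 0; 0; 0; 12; 0; 15];
      [:: 7; 4; 10; 0; 0; 6];
      [:: 7; 4; 8; 0; 16; 5]].

Definition table14 : seq (seq nat) :=
  [:: [:: 21; 0; 0; 0; 21; 0];
      [:: 0; 0; 21; 0; 0; 0];
      [:: 0; 0; 0; 0; 0; 21];
      [:: 0; 21; 0; 21; 0; 0];
      [:: 0; 0; 0; 0; 0; 21];
      [:: 0; 0; 21; 0; 0; 0];
      [:: 21; 0; 0; 0; 21; 0];
      [:: 0; 0; 11; 0; 0; 0];
      [:: 0; 11; 10; 11; 0; 21];
      [:: 0; 0; 11; 0; 0; 0];
      [:: 21; 0; 0; 0; 21; 0];
      [:: 0; 0; 21; 0; 0; 0];
      [:: 0; 0; 0; 0; 0; 21];
      [:: 0; 21; 0; 21; 0; 0]].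

(** For [k = 20] one has [a = 5] and [b = 6], which gives [30 * n + 12]. *)
Lemma kRoman_number20 n : 4 <= n ->
  kRoman_number (@cycle_path_adj 6 n) 20 + 2 * uphalf n <= 30 * n + 12.
Proof.
move=> n4; have n1 : 1 < n by lia.
have := kRoman_number_code 20 n1.
have [n_small|n_big] : n \in [:: 5; 6; 8; 9; 11; 14] \/ n \notin [:: 5; 6; 8; 9; 11; 14].
- by case: (n \in _); [left|right].
- move=> _; have table_le t w : table_dominating 20 t -> w = sumn (map sumn t) ->
      kRoman_number (@cycle_path_adj 6 (size t)) 20 <= w.
    by move=> t_dom ->; exact: kRoman_number_table.
  have := table_le table5 150 isT erefl; have := table_le table6 182 isT erefl.
  have := table_le table9 271 isT erefl; have := table_le table14 411 isT erefl.
  (* The case [n = 11]: the last eleven layers of [table14] dominate on their own. *)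
  have := table_le (drop 3 table14) 327 isT erefl.
  have := table_le table8 237 isT erefl.
  rewrite /= => ? ? ? ? ? ?.
  by move: n_small; rewrite !inE => /or4P[/eqP->|/eqP->|/eqP->|/or3P[]/eqP->]; lia.
(* The code costs at most [28 * n + 28], against a target of about [29 * n + 12]. *)
rewrite !inE in n_big; lia.
Qed.

(** * The theorem *)

Lemma kRoman_number_bound n k a b : 4 <= n -> 1 <= k ->
  a = (k + 9) %/ 5 -> b = (k + 5 - a) %/ 3 ->
  kRoman_number (@cycle_path_adj 6 n) k + 2 * uphalf n <= 6 * (n - 2) * a + 12 * b.
Proof.
move=> n4 k1 aE bE; have n1 : 1 < n by lia.
(* Rounding up in [b] gives [3 * b + a >= k + 3], so failure here means equality. *)
have [outer|outer] := leqP (k + 4) (3 * b + a).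
  by apply: kRoman_number_slack => //; lia.
have [next|next] := leqP (k + 7) (4 * a + b).
  by apply: kRoman_number_tight => //; lia.
(* From [3 * b + a = k + 3] and [4 * a + b <= k + 6] follows [11 * a <= 2 * k + 15]; with
   [5 * a >= k + 5] this forces [k <= 20]. *)
have : [|| k == 5, k == 9 | k == 20] by lia.
case/or3P => /eqP kE; rewrite kE in aE bE *.
- have [-> ->] : a = 2 /\ b = 2 by split; lia.
  by have := kRoman_number_code 5 n1; lia.
- have [-> ->] : a = 3 /\ b = 3 by split; lia.
  by have := kRoman_number_code 9 n1; lia.
have [-> ->] : a = 5 /\ b = 6 by split; lia.
by have := kRoman_number20 n4; lia.
Qed.

Import Order.TTheory GRing.Theory Num.Theory.
Local Open Scope ring_scope.

Lemma ceil_nat_div (m d : nat) : (0 < d)%N ->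
  Num.ceil (m%:R / d%:R : rat) = ((m + d.-1) %/ d)%N%:Z.
Proof.
move=> d0; apply: ceil_def; have dR : 0 < d%:R :> rat by rewrite ltr0n.
rewrite rmorphB /= -pmulrn ltrBlDr -[X in _ / _ + X](divff (lt0r_neq0 dR)) -mulrDl.
rewrite ltr_pdivlMr // ler_pdivrMr // -natrD -!natrM ltr_nat ler_nat.
have := leq_divM (m + d.-1) d; have := ltn_ceil (m + d.-1) d0; lia.
Qed.

Theorem theorem12 (n k : nat) (hn : (4 <= n)%N) (hk : (1 <= k)%N) :
  [/\ (kRoman_number (@cycle_path_adj 6 n) k)%:Z <=
        6 * (n%:Z - 2) * Num.ceil ((k%:R + 5) / 5 : rat)
        + 12 * Num.ceil ((k%:R + 3
                          - (Num.ceil ((k%:R + 5) / 5 : rat))%:~R) / 3 : rat)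
        - 2 * Num.ceil (n%:R / 2 : rat),
      ~~ odd n ->
        (kRoman_number (@cycle_path_adj 6 n) k)%:R <=
        (6 * n%:R * k%:R + 55 * n%:R + 4 * k%:R - 20) / 5 :> rat
    & odd n ->
        (kRoman_number (@cycle_path_adj 6 n) k)%:R <=
        (6 * n%:R * k%:R + 55 * n%:R + 4 * k%:R - 25) / 5 :> rat].
Proof.
set a := ((k + 9) %/ 5)%N; set b := ((k + 5 - a) %/ 3)%N.
have aE : Num.ceil ((k%:R + 5) / 5 : rat) = a by rewrite -natrD ceil_nat_div // -addnA.
(* This makes the truncated subtraction in [b] agree with the rational one. *)
have ak : (a <= k + 3)%N by lia.
have bE : Num.ceil ((k%:R + 3 - a%:Z%:~R) / 3 : rat) = b.
  rewrite -natrD -pmulrn -natrB // ceil_nat_div //; congr Posz; rewrite /b; lia.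
have nE : Num.ceil (n%:R / 2 : rat) = uphalf n.
  by rewrite ceil_nat_div // addn1 divn2.
have := kRoman_number_bound hn hk (erefl a) (erefl b).
move: (kRoman_number _ _) => g bound.
(* After [3 * b <= k + 5 - a], the coefficient of [a] in five times the bound is [5 * (6 * n - 16)],
   which is positive, so [5 * a <= k + 9] can be used. The term [5 * odd n] comes from
   [10 * uphalf n]. *)
have bound5 : (5 * g + 20 + 5 * odd n <= 6 * n * k + 55 * n + 4 * k)%N.
  have : (5 * ((6 * n - 16) * a) <= (6 * n - 16) * (k + 9))%N.
    by rewrite mulnCA leq_mul2l /a; lia.
  have : (3 * b <= k + 5 - a)%N by rewrite /b; lia.
  nia.
have gR (c : nat) : (5 * g + c <= 6 * n * k + 55 * n + 4 * k)%N ->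
    g%:R <= (6 * n%:R * k%:R + 55 * n%:R + 4 * k%:R - c%:R) / 5 :> rat.
  rewrite ler_pdivlMr // lerBrDr -(ler_nat rat) !natrD !natrM; lra.
split; first by rewrite aE bE nE; nia.
  by move=> /negPf n_even; apply: (gR 20); rewrite n_even in bound5; lia.
by move=> n_odd; apply: (gR 25); rewrite n_odd in bound5; lia.
Qed.
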